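(* Fix an integer $m \ge 3$. If $S = \langle 3, 3m + 1, 3m + 2\rangle$, then $$\Delta_\infty(S) = \{1, 2, \ldots , m+1\} \cup \{2m, 2m+1\}.$$
   Context: $\langle a_1, a_2, a_3\rangle$ denotes the set of all $\mathbb{Z}_{\ge 0}$-linear combinations of $a_1,a_2,a_3$. For the numerical semigroup $S$ with minimal generators $a_1 = 3$, $a_2 = 3m+1$, $a_3 = 3m+2$ and $x \in S$, the set of factorizations is $\mathsf Z(x) = \{z \in \mathbb{Z}_{\ge 0}^3 : x = z_1a_1 + z_2a_2 + z_3a_3\}$. For $z \in \mathsf Z(x)$, $\ell_\infty(z) = \max(z_1,z_2,z_3)$; $\mathcal L_\infty(x) = \{\ell_\infty(z) : z \in \mathsf Z(x)\}$. Writing $\mathcal L_\infty(x) = \{c_1 < \cdots < c_r\}$, put $\Delta_\infty(x) = \{c_i - c_{i-1} : i = 2, \ldots, r\}$, and $\Delta_\infty(S) = \bigcup_{x \in S} \Delta_\infty(x)$. *)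

(* Defs.v *)
From mathcomp Require Import all_boot.
From mathcomp Require Import classical_sets.

Set Implicit Arguments.
Unset Strict Implicit.
Unset Printing Implicit Defensive.

Local Open Scope nat_scope.
Local Open Scope classical_set_scope.

(* Throughout, [a] lists the generators of the semigroup.  Factorizations are
   taken with respect to this list, so the definitions from [factorizations]
   on agree with the invariants of the semigroup when [a] is its minimal
   generating set. *)

Definition semigroup_gen k (a : k.-tuple nat) : set nat :=
  [set x | exists z : k.-tuple nat, x = \sum_(i < k) tnth z i * tnth a i].

Definition factorizations k (a : k.-tuple nat) (x : nat) : set (k.-tuple nat) :=
  [set z | x = \sum_(i < k) tnth z i * tnth a i].

Definition ell_infty k (z : k.-tuple nat) : nat := \max_(i < k) tnth z i.

Definition length_set_infty k (a : k.-tuple nat) (x : nat) : set nat :=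
  @ell_infty k @` factorizations a x.

(* Differences of consecutive elements of a subset of [nat]. *)
Definition gaps (L : set nat) : set nat :=
  [set d | exists c c' : nat,
     [/\ L c, L c', c < c', forall e, L e -> ~~ (c < e < c') & d = c' - c]].

Definition Delta_infty_elt k (a : k.-tuple nat) (x : nat) : set nat :=
  gaps (length_set_infty a x).

Definition Delta_infty k (a : k.-tuple nat) : set nat :=
  \bigcup_(x in semigroup_gen a) Delta_infty_elt a x.

(* Main.v *)
Require Import Defs.
From mathcomp Require Import all_boot.
From mathcomp Require Import classical_sets.
From mathcomp Require Import zify.

(** Write a factorization as a triple [(a, b, c)].  The semigroup has three
    basic trades, 2 e2 = m e1 + e3, 2 e3 = (m + 1) e1 + e2 and
    e2 + e3 = (2m + 1) e1, whose combination e1 + 3 e2 = 3 e3 moves the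
    coordinates by at most 3.

    No gap lies outside the stated set.  Let a factorization have maximum [M],
    and let the next smaller value of the maximum be below [M - (m + 1)].  One
    of the trades always lowers the maximum by an amount between 1 and [m + 1]
    ([exists_slightly_shorter]), with two exceptions.  If all three coordinates
    are already close to [M], the weight of the factorization is so large that
    no maximum can be as low as [M - (m + 2)] ([near_balanced_nearly_shortest]).
    If the factorization is [(a, 0, 0)], the only trade is with e2 + e3, which
    costs [2m + 1]; this gap is shortened only if the coordinate 1 created by
    the trade exceeds what remains of [a], and then it is [2m]
    ([jump_from_multiple_of_3]).

    All the values occur.  The elements [6m + 6], [6m + 3] and [6m + 10] have
    just two factorizations each and give [2m + 1], [2m] and [m + 1].  For the
    values up to [m], sort the factorizations of a large multiple of 3 by their
    level [b + c].  If [a] is the dominant coordinate, each level contributes an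
    interval of values of [a]: it is about [m] below the preceding one, and its
    length grows by 1 whenever the level grows by 3.  So the space between the
    intervals of the levels [3j] and [3j + 1] shrinks as [j] grows, and it is
    exactly [m + 1 - j] ([gap_between_levels]). *)

Local Open Scope nat_scope.
Local Open Scope classical_set_scope.

(** * Factorizations as triples *)

Definition weight (m a b c : nat) : nat :=
  3 * a + (3 * m + 1) * b + (3 * m + 2) * c.

Definition max3 (a b c : nat) : nat := maxn a (maxn b c).

Lemma length_setP (m x l : nat) :
  length_set_infty [tuple 3; 3 * m + 1; 3 * m + 2] x l <->
  exists a b c, x = weight m a b c /\ l = max3 a b c.
Proof.
split.
- case=> z; rewrite /factorizations /= /ell_infty !big_ord_recr !big_ord0 /=.
  move=> -> <-; exists (tnth z ord0), (tnth z (inord 1)), (tnth z (inord 2)).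
  have -> : inord 1 = widen_ord (leqnSn 2) ord_max :> 'I_3.
    by apply/val_inj; rewrite /= inordK.
  have -> : inord 2 = ord_max :> 'I_3 by apply/val_inj; rewrite /= inordK.
  have -> : ord0 = widen_ord (leqnSn 2) (widen_ord (leqnSn 1) ord_max) :> 'I_3.
    exact/val_inj.
  rewrite !(tnth_nth 0) /= /weight /max3; split; lia.
case=> a [b [c [-> ->]]]; exists [tuple a; b; c].
- rewrite /factorizations /= !big_ord_recr !big_ord0 /= !(tnth_nth 0) /=.
  rewrite /weight; lia.
- rewrite /ell_infty !big_ord_recr !big_ord0 /= !(tnth_nth 0) /= /max3; lia.
Qed.

Lemma Delta_inftyP (m d : nat) :
  Delta_infty [tuple 3; 3 * m + 1; 3 * m + 2] d <->
  exists a b c a' b' c',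
    [/\ weight m a b c = weight m a' b' c',
        max3 a b c + d = max3 a' b' c',
        0 < d &
        forall u v t, weight m u v t = weight m a' b' c' ->
          ~~ (max3 a b c < max3 u v t < max3 a' b' c')].
Proof.
split.
- case=> x _ [l [l' [/length_setP [a [b [c [xE lE]]]]]]].
  case/length_setP=> a' [b' [c' [xE' lE']]] ltl between ->.
  exists a, b, c, a', b', c'; split; try lia.
  move=> u v t wE; rewrite -lE -lE'; apply: between.
  by apply/length_setP; exists u, v, t; rewrite wE.
case=> a [b [c [a' [b' [c' [wE maxE dgt0 between]]]]]].
exists (weight m a b c).
- exists [tuple a; b; c].
  rewrite !big_ord_recr !big_ord0 /= !(tnth_nth 0) /= /weight; lia.
exists (max3 a b c), (max3 a' b' c'); split; try lia.
- by apply/length_setP; exists a, b, c.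
- by apply/length_setP; exists a', b', c'; rewrite wE.
- move=> e /length_setP [u [v [t [eE ->]]]].
  by apply: between; rewrite -eE wE.
Qed.

(** * Large gaps *)

(** The trades below keep the maximum strictly under [M] because the coordinates
    that they raise leave room: if [a] is the maximum, replace [m] or [m + 1]
    copies of 3; if [b] or [c] is the maximum and the other one is not close to
    it, exchange three of them; if both are close to the maximum and [a] is not,
    replace one of each by [2m + 1] copies of 3. *)
Lemma exists_slightly_shorter (m a b c M : nat) :
  3 <= m -> M = max3 a b c -> m + 2 <= M -> 0 < b + c ->
  ~~ [&& M <= a + (2 * m + 1), M <= b + 3 & M <= c + 3] ->
  exists a' b' c', weight m a' b' c' = weight m a b c /\
    M - (m + 1) <= max3 a' b' c' < M.
Proof.
rewrite /max3 /weight => m3 ME leM bc unbal.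
have [/andP[bM cM]|side] := boolP ((M <= b + 3) && (M <= c + 3)).
  have ltaM : a + (2 * m + 1) < M by lia.
  have [b1 bE] : exists b1, b = b1.+1 by exists b.-1; lia.
  have [c1 cE] : exists c1, c = c1.+1 by exists c.-1; lia.
  by subst b c; exists (a + (2 * m + 1)), b1, c1; lia.
have [aM|aM] := eqVneq a M.
  have [[c0 bM]|[b0 cM]] : (0 < c /\ b + 2 < M) \/ (0 < b /\ c + 2 < M) by lia.
    have [c1 cE] : exists c1, c = c1.+1 by exists c.-1; lia.
    have [a1 aE] : exists a1, a = a1 + m by exists (a - m); lia.
    by subst a c; exists a1, b.+2, c1; lia.
  have [b1 bE] : exists b1, b = b1.+1 by exists b.-1; lia.
  have [a1 aE] : exists a1, a = a1 + m.+1 by exists (a - m.+1); lia.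
  by subst a b; exists a1, b1, c.+2; lia.
have [bM|bM] := eqVneq b M.
  (* Exchanging three e2 for three e3 consumes one e1; with none available,
     the trade 2 e2 = m e1 + e3 fits because m < M. *)
  have [a0|a0] := posnP a.
    have [b1 bE] : exists b1, b = b1.+2 by exists (b - 2); lia.
    by subst b; exists (a + m), b1, c.+1; lia.
  have [a1 aE] : exists a1, a = a1.+1 by exists a.-1; lia.
  have [b1 bE] : exists b1, b = b1.+3 by exists (b - 3); lia.
  by subst a b; exists a1, b1, c.+3; lia.
have [ac|ac] := ltnP a.+1 c.
  have [c1 cE] : exists c1, c = c1.+3 by exists (c - 3); lia.
  by subst c; exists a.+1, b.+3, c1; lia.
(* Here a = c - 1, so the trade e1 + 3 e2 = 3 e3 would create a new maximum;
   lower both a and c instead. *)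
have [c1 cE] : exists c1, c = c1.+1 by exists c.-1; lia.
have [a1 aE] : exists a1, a = a1 + m by exists (a - m); lia.
by subst a c; exists a1, b.+2, c1; lia.
Qed.

(** The weight of a triple is at most [6 (m + 1)] times its maximum, and a triple
    whose coordinates are all close to [M] falls short of [6 (m + 1) M] by
    less than [6 (m + 1) (m + 2)]. *)
Lemma near_balanced_nearly_shortest (m a b c u v t M : nat) :
  3 <= m -> weight m u v t = weight m a b c ->
  [&& M <= a + (2 * m + 1), M <= b + 3 & M <= c + 3] ->
  M < max3 u v t + (m + 2).
Proof.
rewrite /weight => m3 wE /and3P[aM bM cM]; rewrite ltnNge; apply/negP.
set l := max3 u v t => leM.
have [ul vl tl] : [/\ u <= l, v <= l & t <= l] by rewrite /l /max3; split; lia.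
have : m * (v + t) <= m * (l + l) by rewrite leq_mul2l; lia.
have : m * (l + l + (2 * m + 4)) <= m * (b + 3 + (c + 3)).
  by rewrite leq_mul2l; lia.
have : 3 * m <= m * m by rewrite leq_mul2r m3 orbT.
lia.
Qed.

(** Any factorization other than [(a, 0, 0)] has [b + c >= 2] by congruence
    modulo 3, and costs at least [2m + 1] copies of 3.  Its maximum can exceed
    [a - (2m + 1)] only if it is attained by [v] or [t], which the weight
    allows only for [a = 2m + 1]. *)
Lemma jump_from_multiple_of_3 (m a u v t : nat) :
  3 <= m -> weight m u v t = weight m a 0 0 -> u < a ->
  2 * m + 1 <= a /\
  (max3 u v t <= a - (2 * m + 1) \/ a = 2 * m + 1 /\ max3 u v t = 1).
Proof.
rewrite /weight => m3 wE ua.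
have vt2 : 2 <= v + t by case: v t wE => [|[|v]] [|[|t]] wE; nia.
have : m * 2 <= m * (v + t) by rewrite leq_mul2l vt2 orbT.
move=> wvt; have lea : u + (2 * m + 1) <= a by lia.
split; first lia.
have [k aE] : exists k, a = k + (2 * m + 1) by exists (a - (2 * m + 1)); lia.
subst a; rewrite /max3.
have [vtk|vtk] := leqP (maxn v t) k; first by left; lia.
have : m * k.+1 <= m * maxn v t by rewrite leq_mul2l vtk orbT.
have : m * maxn v t <= m * (v + t) by rewrite leq_mul2l; lia.
move=> le1 le2.
(* 3 m k <= 3 m + 2 + 2 k, hence k <= 1 *)
have k1 : k <= 1.
  rewrite leqNgt; apply/negP => k2.
  have : 3 * k <= m * k by rewrite leq_mul2r m3 orbT.
  have : m * 2 <= m * k by rewrite leq_mul2l k2 orbT.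
  nia.
have vt3 : v + t <= 2.
  rewrite leqNgt; apply/negP => vt3.
  have : m * 3 <= m * (v + t) by rewrite leq_mul2l vt3 orbT.
  lia.
right; case: k k1 vtk {le2} wE lea ua => [|[|k]] // _;
case: v t vt3 vt2 {wvt le1} => [|[|[|v]]] [|[|[|t]]] // _ _; lia.
Qed.

Lemma large_gap (m d : nat) :
  3 <= m -> Delta_infty [tuple 3; 3 * m + 1; 3 * m + 2] d -> m + 1 < d ->
  d = 2 * m \/ d = 2 * m + 1.
Proof.
move=> m3 /Delta_inftyP [u [v [t [a [b [c [wE maxE _ between]]]]]]] dm.
have [bc0|bc] := posnP (b + c).
  have [b0 c0] : b = 0 /\ c = 0 by lia.
  subst b c.
  have ua : u < a by move: maxE; rewrite /max3; lia.
  have [am alt] := jump_from_multiple_of_3 m a u v t m3 wE ua.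
  have [k aE] : exists k, a = k + (2 * m + 1) by exists (a - (2 * m + 1)); lia.
  have /between : weight m k 1 1 = weight m a 0 0 by rewrite /weight; lia.
  move: alt maxE; rewrite /max3; lia.
have [bal|unbal] := boolP [&& max3 a b c <= a + (2 * m + 1),
                              max3 a b c <= b + 3 & max3 a b c <= c + 3].
  by have := near_balanced_nearly_shortest m a b c u v t _ m3 wE bal; lia.
have [|a' [b' [c' [w'E lt']]]] :=
  exists_slightly_shorter m a b c _ m3 erefl _ bc unbal; first by lia.
by have := between _ _ _ w'E; lia.
Qed.

(** * Realizing the gaps *)

Lemma gap_two_m (m : nat) :
  3 <= m -> Delta_infty [tuple 3; 3 * m + 1; 3 * m + 2] (2 * m).
Proof.
move=> m3; apply/Delta_inftyP; exists 0, 1, 1, (2 * m + 1), 0, 0.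
split; rewrite /weight /max3; try lia.
move=> u v t wE.
have ua : u <= 2 * m + 1 by lia.
have [->|neq] := eqVneq u (2 * m + 1); first lia.
have ult : u < 2 * m + 1 by rewrite ltn_neqAle neq.
have := jump_from_multiple_of_3 m (2 * m + 1) u v t m3 wE ult.
rewrite /max3; lia.
Qed.

Lemma gap_two_m_add_one (m : nat) :
  3 <= m -> Delta_infty [tuple 3; 3 * m + 1; 3 * m + 2] (2 * m + 1).
Proof.
move=> m3; apply/Delta_inftyP; exists 1, 1, 1, (2 * m + 2), 0, 0.
split; rewrite /weight /max3; try lia.
move=> u v t wE.
have ua : u <= 2 * m + 2 by lia.
have [->|neq] := eqVneq u (2 * m + 2); first lia.
have ult : u < 2 * m + 2 by rewrite ltn_neqAle neq.
have := jump_from_multiple_of_3 m (2 * m + 2) u v t m3 wE ult.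
rewrite /max3; lia.
Qed.

(** In [6m + 10] the coordinate [a] of the smaller factorization [(2, 0, 2)] is
    just large enough for the [m + 1] copies of 3 spent on the trade
    (m + 1) e1 + e2 = 2 e3 to be seen in full. *)
Lemma gap_m_add_one (m : nat) :
  3 <= m -> Delta_infty [tuple 3; 3 * m + 1; 3 * m + 2] (m + 1).
Proof.
move=> m3; apply/Delta_inftyP; exists 2, 0, 2, (m + 3), 1, 0.
split; rewrite /weight /max3; try lia.
move=> u v t wE.
have vt : v + t <= 2.
  rewrite leqNgt; apply/negP => vt3.
  have : m * 3 <= m * (v + t) by rewrite leq_mul2l vt3 orbT.
  lia.
case: v t vt wE => [|[|[|v]]] [|[|[|t]]] // _; lia.
Qed.

(** The gap is between the lowest value of [a] on level [3j], attained with all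
    of the level in [c], and the highest one on level [3j + 1], where [c = 2] is
    the least value allowed modulo 3.  The lower value [9m] bounds the other
    coordinates of every factorization of the element, so that all maxima in
    this range are values of [a]. *)
Lemma gap_between_levels (m j : nat) :
  3 <= m -> 0 < j <= m ->
  Delta_infty [tuple 3; 3 * m + 1; 3 * m + 2] (m + 1 - j).
Proof.
move=> m3 /andP[j0 jm]; apply/Delta_inftyP.
have [d dE] : exists d, m + 1 = d + j by exists (m + 1 - j); lia.
have -> : m + 1 - j = d by lia.
have [i jE] : exists i, j = i.+1 by exists j.-1; lia.
exists (9 * m), (3 * i + 2), 2, (9 * m + d), 0, (3 * j).
have mm : 3 * m <= m * m by rewrite leq_mul2r m3 orbT.
have mj : m * j <= m * m by rewrite leq_mul2l jm orbT.
split; [| by rewrite /max3; lia | by lia |].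
  have -> : m = d + i by lia.
  by rewrite /weight jE; lia.
move=> u v t wE.
have vt9 : v + t <= 9 * m.
  rewrite leqNgt; apply/negP => vt9.
  have : m * (9 * m).+1 <= m * (v + t) by rewrite leq_mul2l vt9 orbT.
  move: wE; rewrite /weight; lia.
suff : (u <= 9 * m) || (9 * m + d <= u) by rewrite /max3; lia.
have [lvl|lvl] := leqP (v + t) (3 * j).
  have : m * (v + t) <= m * (3 * j) by rewrite leq_mul2l lvl orbT.
  move: wE; rewrite /weight; lia.
have : m * (3 * j).+1 <= m * (v + t) by rewrite leq_mul2l lvl orbT.
have [lvl2|lvl2] := leqP (v + t) (3 * j).+1; last first.
  have : m * (3 * j).+2 <= m * (v + t) by rewrite leq_mul2l lvl2 orbT.
  move: wE; rewrite /weight; lia.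
have vE : v + t = (3 * j).+1 by lia.
have : m * (v + t) = m * (3 * j).+1 by rewrite vE.
move: wE; rewrite /weight; lia.
Qed.

Theorem theorem3p3 (m : nat) (hm : 3 <= m) :
  Delta_infty [tuple 3; 3 * m + 1; 3 * m + 2] =
  [set d : nat | 1 <= d <= m + 1] `|` [set 2 * m; 2 * m + 1].
Proof.
apply/seteqP; split => d.
- move=> dD; have [dm|dm] := leqP d (m + 1); last first.
    by right; apply: large_gap.
  left; move/Delta_inftyP: dD => [a [b [c [a' [b' [c' [_ _ d0 _]]]]]]] /=.
  by rewrite d0.
- case=> [/= /andP[d0 dm]|[->|->]]; last 2 first.
  + exact: gap_two_m.
  + exact: gap_two_m_add_one.
  have [->|dm1] := eqVneq d (m + 1); first exact: gap_m_add_one.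
  have -> : d = m + 1 - (m + 1 - d) by lia.
  by apply: gap_between_levels => //; lia.
Qed.
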